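(* Let $X$ be an infinite ultrahomogeneous discrete chain and $G=(\mathrm{Aut}(X),\tau_\partial)$. Then: (a) $e_{b_mX}G$ is the completion of $(G,R_{\Sigma_{b_mX}})$; (b) $G$ is Roelcke precompact, $b_rG\leq e_{b_mX}G$, and $\mathfrak E(b_rG)=e_{b_mX}G$; (c) $e_{b_mX}G$ is the set of maps $f:b_mX\to b_mX$, with the topology of pointwise convergence, such that (i) $f$ is non-decreasing; (ii) $f(x)\notin X$ whenever $x\in b_mX\setminus X$; (iii) if $f(x)=f(y)$ with $x\neq y$ then $f(x)\in b_mX\setminus X$; (iv) for every $x\in X$ either $f((x,-1))=f((x,0))=f((x,1))\notin X$, or there is $y\in X$ with $f((x,j))=(y,j)$ for $j=-1,0,1$; (v) $f(\inf)=\inf$, $f(\sup)=\sup$; (d) $b_rG$ is the set of maps $f:X\to b_mX$, with the topology of pointwise convergence, which are non-decreasing and such that $f(x)=f(y)$ with $x\neq y$ implies $f(x)\in b_mX\setminus X$. If $X$ is continuously ordered, then $b_rG=e_{b_mX}G$.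
   Context: Ultrahomogeneous chain: for all $x_1<\dots<x_n$, $y_1<\dots<y_n$ there is an order automorphism with $g(x_k)=y_k$. $\tau_\partial$: topology of pointwise convergence for discrete $X$. $b_mX$: $X\times\{-1,0,1\}$ (lexicographic order) plus one point for each gap of $X$ (cut $(A,B)$, $A<B$, $A$ without max, $B$ without min, including $\inf$ ($A=\emptyset$) and $\sup$ ($B=\emptyset$)), with order topology, $X\equiv X\times\{0\}$; $G$ acts by $g(x,j)=(gx,j)$, $g(A,B)=(gA,gB)$. $e_KG$ is the closure of $\iota_K(G)$, $\iota_K(g)(x)=gx$, in $K^K$. For a $G$-set $Z$, $\mathrm{St}_\sigma$ is the pointwise stabilizer of a finite $\sigma\subset Z$ and $R_{\Sigma_Z}$ is the uniformity on $G$ with base covers $\{Og\,\mathrm{St}_\sigma:g\in G\}$. Roelcke precompact: the uniformity with base covers $\{OgO\}$ is totally bounded; $b_rG$ is the completion in it. For a $G$-compactification $bG$ of $G$ (left action), $\mathfrak E(bG)=e_{bG}G$. Continuously ordered: densely ordered without proper gaps. *)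

(* Defs.v *)
From Stdlib Require List.
From HB Require Import structures.
From mathcomp Require Import all_boot all_order.
From mathcomp Require Import boolp classical_sets cardinality.
Set Implicit Arguments. Unset Strict Implicit. Unset Printing Implicit Defensive.
Import Order.TTheory.
Local Open Scope order_scope.
Local Open Scope classical_set_scope.

(* nb x : set (set T) is a base of neighbourhoods of x.                *)
Section Topo.
Variable T : Type.
Variable nb : T -> set (set T).

Definition cl (S : set T) : set T :=
  [set x | forall N, nb x N -> exists y, S y /\ N y].

Definition nb_open (U : set T) :=
  forall x, U x -> exists N, nb x N /\ (forall y, N y -> U y).

Definition compact_in (S : set T) :=
  forall C : set (set T), (forall U, C U -> nb_open U) ->
    (forall x, S x -> exists U, C U /\ U x) ->
    exists l : seq (set T), (forall U, List.In U l -> C U) /\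
      (forall x, S x -> exists U, List.In U l /\ U x).

Definition hausdorff_in (S : set T) :=
  forall x y, S x -> S y -> x <> y ->
    exists N M, nb x N /\ nb y M /\ (forall z, N z -> M z -> False).
End Topo.

Definition pw_nb (A T : Type) (nb : T -> set (set T)) (f : A -> T)
    (N : set (A -> T)) : Prop :=
  exists (zs : seq A) (V : A -> set T),
    (forall z, List.In z zs -> nb (f z) (V z)) /\
    N = [set g | forall z, List.In z zs -> V z (g z)].

Definition cont_on (T1 T2 : Type) (nb1 : T1 -> set (set T1))
    (nb2 : T2 -> set (set T2)) (S : set T1) (phi : T1 -> T2) :=
  forall x, S x -> forall N, nb2 (phi x) N ->
    exists M, nb1 x M /\ forall y, S y -> M y -> N (phi y).

Definition unif_gen (G : Type) (B : set (set (G * G))) : set (set (G * G)) :=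
  [set E | exists W, B W /\ (forall p, W p -> E p)].

Definition cover_ent (G : Type) (C : set (set G)) : set (G * G) :=
  [set p | exists c, C c /\ c p.1 /\ c p.2].

Definition totally_bounded (G : Type) (U : set (set (G * G))) :=
  forall E, U E -> exists xs : seq G, forall a, exists x, List.In x xs /\ E (x, a).

Definition img (G T : Type) (iota : G -> T) : set T := [set y | exists g, iota g = y].

(* the uniformity induced on G by iota from the unique uniformity of the
   compact Hausdorff space S (= all neighbourhoods of the diagonal of S x S) *)
Definition induced_unif (G T : Type) (nb : T -> set (set T)) (S : set T)
    (iota : G -> T) : set (set (G * G)) :=
  [set E | exists N : set (T * T),
     (forall k, S k -> exists V, nb k V /\
        forall u v, S u -> S v -> V u -> V v -> N (u, v)) /\
     (forall a b, N (iota a, iota b) -> E (a, b))].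

(* (S, iota) is the completion of the uniform space (G, U):
   S is compact Hausdorff (hence complete for its unique uniformity),
   iota : G -> S is injective with dense image, and U is the induced
   uniformity. *)
Definition is_completion (G T : Type) (U : set (set (G * G)))
    (nb : T -> set (set T)) (S : set T) (iota : G -> T) :=
  [/\ (forall g, S (iota g)), injective iota,
      (forall x, S x -> cl nb (img iota) x),
      (compact_in nb S /\ hausdorff_in nb S) & U = induced_unif nb S iota].

Definition comp_le (G T1 T2 : Type) (nb1 : T1 -> set (set T1)) (S1 : set T1)
    (iota1 : G -> T1) (nb2 : T2 -> set (set T2)) (S2 : set T2) (iota2 : G -> T2) :=
  exists phi : T2 -> T1, (forall x, S2 x -> S1 (phi x)) /\
    cont_on nb2 nb1 S2 phi /\ (forall g, phi (iota2 g) = iota1 g).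

Definition comp_iso (G T1 T2 : Type) (nb1 : T1 -> set (set T1)) (S1 : set T1)
    (iota1 : G -> T1) (nb2 : T2 -> set (set T2)) (S2 : set T2) (iota2 : G -> T2) :=
  exists (phi : T1 -> T2) (psi : T2 -> T1),
    [/\ (forall x, S1 x -> S2 (phi x)) /\ (forall y, S2 y -> S1 (psi y)),
        (forall x, S1 x -> psi (phi x) = x) /\ (forall y, S2 y -> phi (psi y) = y),
        (cont_on nb1 nb2 S1 phi /\ cont_on nb2 nb1 S2 psi) &
        (forall g, phi (iota1 g) = iota2 g)].

Inductive sgn := Mi | Ze | Pl.
Definition sgn_lt (i j : sgn) : Prop :=
  match i, j with Mi, Ze | Mi, Pl | Ze, Pl => True | _, _ => False end.

Section Chain.
Variables (d : Order.disp_t) (X : orderType d).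

Record aut := Aut {
  afun : X -> X; ainv : X -> X;
  afunK : cancel afun ainv; ainvK : cancel ainv afun;
  afun_mono : {mono afun : x y / x <= y} }.

Definition ultrahomogeneous :=
  forall s t : seq X, sorted <%O s -> sorted <%O t -> size s = size t ->
    exists g : aut, map (afun g) s = t.

Definition is_gap (A : set X) : Prop :=
  [/\ (forall a b, a <= b -> A b -> A a),
      (forall a, A a -> exists a', A a' /\ a < a') &
      (forall b, ~ A b -> exists b', ~ A b' /\ b' < b)].

Definition gap := {A : set X | is_gap A}.

Inductive bm := Pt of X & sgn | Gp of gap.

Definition bm_lt (u v : bm) : Prop :=
  match u, v with
  | Pt x i, Pt y j => x < y \/ (x = y /\ sgn_lt i j)
  | Pt x _, Gp A => proj1_sig A x
  | Gp A, Pt y _ => ~ proj1_sig A y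
  | Gp A, Gp B => (forall z, proj1_sig A z -> proj1_sig B z) /\
                  proj1_sig A <> proj1_sig B
  end.
Definition bm_le (u v : bm) := bm_lt u v \/ u = v.

Definition emb (x : X) : bm := Pt x Ze.
Definition inX (u : bm) := exists x, u = emb x.

Definition lbound (l : option bm) (v : bm) :=
  match l with Some a => bm_lt a v | None => True end.
Definition ubound (r : option bm) (v : bm) :=
  match r with Some b => bm_lt v b | None => True end.
Definition ord_nb (u : bm) (N : set bm) :=
  exists l r, lbound l u /\ ubound r u /\ N = [set v | lbound l v /\ ubound r v].

Lemma afun_lt (g : aut) : {mono afun g : x y / x < y}.
Proof. by move=> x y; rewrite !ltNge (afun_mono g). Qed.

Lemma ainv_mono (g : aut) : {mono ainv g : x y / x <= y}.
Proof. by move=> x y; rewrite -(afun_mono g) !ainvK. Qed.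

Lemma gap_pre (g : aut) (A : gap) : is_gap [set y | proj1_sig A (ainv g y)].
Proof.
case: A => A [Hd Hm Hn] /=; split.
- by move=> a b ab; apply: Hd; rewrite ainv_mono.
- move=> a /Hm [a' [Aa' lt]]; exists (afun g a'); rewrite /= afunK; split=> //.
  by rewrite -(afun_lt g) ainvK in lt.
- move=> b /Hn [b' [Ab' lt]]; exists (afun g b'); rewrite /= afunK; split=> //.
  by rewrite -(afun_lt g) ainvK in lt.
Qed.

Definition act (g : aut) (u : bm) : bm :=
  match u with
  | Pt x i => Pt (afun g x) i
  | Gp A => Gp (exist _ _ (gap_pre g A))
  end.

Definition stabX (F : seq X) : set aut :=
  [set h | forall x, List.In x F -> afun h x = x].
Definition stabB (s : seq bm) : set aut :=
  [set h | forall u, List.In u s -> act h u = u].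

Definition dcos (O P : set aut) (g : aut) : set aut :=
  [set a | exists o p, O o /\ P p /\ forall x, afun a x = afun o (afun g (afun p x))].

Definition R_Sigma_bm : set (set (aut * aut)) :=
  unif_gen [set W | exists (F : seq X) (s : seq bm),
    W = cover_ent [set c | exists g, c = dcos (stabX F) (stabB s) g]].

Definition roelcke_unif : set (set (aut * aut)) :=
  unif_gen [set W | exists F : seq X,
    W = cover_ent [set c | exists g, c = dcos (stabX F) (stabX F) g]].

Definition roelcke_precompact := totally_bounded roelcke_unif.

Definition embK (g : aut) : bm -> bm := act g.
Definition eK : set (bm -> bm) := cl (pw_nb ord_nb) (img embK).

Definition Cset (f : bm -> bm) : Prop :=
  [/\ (forall u v, bm_le u v -> bm_le (f u) (f v)),
      (forall u, ~ inX u -> ~ inX (f u)),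
      (forall u v, u <> v -> f u = f v -> ~ inX (f u)),
      (forall x, (f (Pt x Mi) = f (Pt x Ze) /\ f (Pt x Ze) = f (Pt x Pl) /\
                  ~ inX (f (Pt x Ze))) \/
                 exists y, [/\ f (Pt x Mi) = Pt y Mi, f (Pt x Ze) = Pt y Ze &
                               f (Pt x Pl) = Pt y Pl]) &
      (forall A : gap, (proj1_sig A = set0 -> f (Gp A) = Gp A) /\
                       (proj1_sig A = setT -> f (Gp A) = Gp A))].

Definition Dset (f : X -> bm) : Prop :=
  (forall x y, x <= y -> bm_le (f x) (f y)) /\
  (forall x y, x <> y -> f x = f y -> ~ inX (f x)).
Definition embR (g : aut) : X -> bm := fun x => act g (emb x).

(* Ellis compactification of the G-space D: closure of G in D^D *)
Definition Dt := {f : X -> bm | Dset f}.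
Definition embD (g : aut) : Dt -> (X -> bm) := fun f x => act g (proj1_sig f x).
Definition eD : set (Dt -> X -> bm) :=
  [set Phi | (forall f, Dset (Phi f)) /\ cl (pw_nb (pw_nb ord_nb)) (img embD) Phi].

Definition continuously_ordered :=
  (forall x y : X, x < y -> exists z, x < z < y) /\
  (forall A : gap, proj1_sig A = set0 \/ proj1_sig A = setT).

End Chain.

(* Main.v *)
Require Import Defs.
From HB Require Import structures.
From mathcomp Require Import all_boot all_order.
From mathcomp Require Import boolp classical_sets cardinality.
From Stdlib Require List Sorted.
From mathcomp Require Import filter.
Set Implicit Arguments. Unset Strict Implicit. Unset Printing Implicit Defensive.
Import Order.TTheory.
Local Open Scope order_scope.
Local Open Scope classical_set_scope.

(** A point [v] of [bm X] is determined by its position (below, equal, above)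
    relative to each isolated point [(x, 0)], and the order topology is the topology
    of pointwise convergence of these positions, so every topology in play is that of
    a set of three-valued functions; compactness is a finite approximation property.

    Density: to approximate [f] at finitely many pairs [(u, z)] one only needs the
    values of [g^-1] at the points [z], since the position of [g u] relative to [z] is
    that of [u] relative to [g^-1 z]; these values are chosen one by one and realised
    by ultrahomogeneity.  Uniformities: if [a] and [b] give the same positions on
    [s x F], then gluing [b] near [s] (gaps included) with [a] at [a^-1 F] gives an
    automorphism [q] with [q a^-1] in the stabilizer of [F] and [q^-1 b] in that of
    [s], so [a] and [b] lie in the same double coset.  Finally [F -> (f -> F o f)]
    identifies [e_{b_m X} G] with the Ellis compactification of [b_r G]. *)

(** * Topologies generated by sign-valued coordinates *)

Definition agree (T I : Type) (co : T -> I -> sgn) (l : seq I) (u v : T) :=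
  forall i, List.In i l -> co v i = co u i.

(** The map [co] embeds [T] into a power of the discrete three-point space: it is injective, and
    [nb] generates the same neighbourhoods as the finite agreement conditions. *)
Record coordinates (T I : Type) (nb : T -> set (set T)) (co : T -> I -> sgn) := Coord {
  coord_sub : forall u N, nb u N -> exists l, forall v, agree co l u v -> N v;
  coord_nb : forall u l, exists N, nb u N /\ forall v, N v -> agree co l u v;
  coord_inj : forall u v, (forall i, co u i = co v i) -> u = v }.

Definition pw_co (A T I : Type) (co : T -> I -> sgn) (f : A -> T) (p : A * I) : sgn :=
  co (f p.1) p.2.

Lemma agree_cat (T I : Type) (co : T -> I -> sgn) l1 l2 u v :
  agree co (l1 ++ l2) u v -> agree co l1 u v /\ agree co l2 u v.
Proof. by move=> H; split=> i Hi; apply: H; apply: List.in_or_app; [left|right]. Qed.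

Lemma agree_sym (T I : Type) (co : T -> I -> sgn) l u v : agree co l u v -> agree co l v u.
Proof. by move=> H i /H ->. Qed.

Lemma agree_trans (T I : Type) (co : T -> I -> sgn) l u v w :
  agree co l u v -> agree co l v w -> agree co l u w.
Proof. by move=> H K i Hi; rewrite K // H. Qed.

(** A coordinate of a function is a coordinate of one of its values. Since the result has the form
    of its hypothesis, it can be iterated, which gives coordinates on the space containing [eD]. *)
Lemma pw_coordinates (A T I : Type) (nb : T -> set (set T)) (co : T -> I -> sgn) :
  coordinates nb co -> coordinates (@pw_nb A T nb) (pw_co co).
Proof.
move=> [H1 H2 H3]; split.
- move=> f _ [zs [V [HV ->]]].
  elim: zs HV => [|a zs IH] HV; first by exists nil => g _ z [].
  have [|l Hl] := IH; first by move=> z Hz; apply: HV; right.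
  have [l' Hl'] := H1 _ _ (HV a (or_introl erefl)).
  exists (List.map (pair a) l' ++ l) => g Hg z; have [Ha Hb] := agree_cat Hg; case=> [<-|Hz].
    by apply: Hl' => i Hi; apply: (Ha (a, i)); exact: List.in_map Hi.
  exact: (Hl _ Hb z Hz).
- move=> f l.
  (* [V a] controls all second components of [l] at once, so it does not matter which of them is
     paired with [a]. *)
  have /choice [V HV] : forall a, exists N, nb (f a) N /\
      forall v, N v -> agree co (List.map snd l) (f a) v by move=> a; apply: H2.
  exists [set g | forall z, List.In z (List.map fst l) -> V z (g z)]; split.
    by exists (List.map fst l), V; split=> // z _; have [] := HV z.
  move=> g Hg [a i] Hi; rewrite /pw_co /=; have [_ Ha] := HV a.
  apply: (Ha (g a)); last exact: (List.in_map snd _ _ Hi).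
  exact: (Hg _ (List.in_map fst _ _ Hi)).
- move=> f g H; apply: funext => a; apply: H3 => i; exact: (H (a, i)).
Qed.

Section Coordinates.
Variables (T I : Type) (nb : T -> set (set T)) (co : T -> I -> sgn).
Hypothesis Hco : coordinates nb co.

Lemma clP (S : set T) x : cl nb S x <-> forall l, exists y, S y /\ agree co l x y.
Proof.
split=> H.
  move=> l; have [N [HN HNl]] := coord_nb Hco x l.
  by have [y [Sy Ny]] := H _ HN; exists y; split=> //; apply: HNl.
move=> N HN; have [l Hl] := coord_sub Hco HN.
by have [y [Sy Hy]] := H l; exists y; split=> //; apply: Hl.
Qed.

Lemma basic_open x l : nb_open nb [set y | agree co l x y].
Proof.
move=> y Hy; have [N [HN HNl]] := coord_nb Hco y l; exists N; split=> // z /HNl.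
exact: agree_trans.
Qed.

Lemma hausdorff_coord (S : set T) : hausdorff_in nb S.
Proof.
move=> x y _ _ xy.
have [i Hi] : exists i, co x i <> co y i.
  by apply: contrapT => H; apply: xy; apply: (coord_inj Hco) => i;
     apply: contrapT => Hi; apply: H; exists i.
have [N [HN HNl]] := coord_nb Hco x [:: i].
have [M [HM HMl]] := coord_nb Hco y [:: i].
exists N, M; split=> //; split=> // z /HNl Hz /HMl Hz'; apply: Hi.
by rewrite -(Hz i (or_introl erefl)) (Hz' i (or_introl erefl)).
Qed.

(* The limiting coordinates [h] are read off an ultrafilter containing [S] and
   the complements of the cover. *)
Lemma compact_coord (S : set T) :
  (forall h : I -> sgn,
     (forall l, exists s, S s /\ forall i, List.In i l -> co s i = h i) ->
     exists s, S s /\ forall i, co s i = h i) ->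
  compact_in nb S.
Proof.
move=> Hcl C Copen Ccov; apply: contrapT => Hno.
pose F : set (set T) := [set P | exists l : seq (set T),
  (forall U, List.In U l -> C U) /\
  forall t, S t -> (forall U, List.In U l -> ~ U t) -> P t].
have FP : ProperFilter F.
  split.
    move=> [l [lC H]]; apply: Hno; exists l; split=> // x Sx.
    apply: contrapT => Hx; apply: (H x Sx) => U lU Ux; apply: Hx; by exists U.
  split.
  - by exists nil.
  - move=> P Q [l [lC HP]] [l' [lC' HQ]]; exists (l ++ l'); split.
      by move=> U HU; case: (List.in_app_or _ _ _ HU) => ?; [apply: lC|apply: lC'].
    by move=> t St Ht; split; [apply: HP|apply: HQ] => // U HU; apply: Ht;
       apply: List.in_or_app; [left|right].
  - by move=> P Q PQ [l [lC HP]]; exists l; split=> // t St Ht; apply: PQ; apply: HP.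
have [G [GU FG]] := ultraFilterLemma FP.
have GP : ProperFilter G by exact: ultra_proper.
have Gex P : G P -> exists t, P t by move=> GP'; apply: (filter_ex GP').
have GS : G S by apply: FG; exists nil.
(* As [sgn] has only three values, the ultrafilter contains a fibre of each coordinate. *)
have /choice [h Hh] : forall i, exists j, G [set t | co t i = j].
  move=> i; apply: contrapT => H.
  have N j : G [set t | co t i <> j].
    by case: (in_ultra_setVsetC [set t | co t i = j] GU) => // Gj; case: H; exists j.
  have [t [[/= t1 t2] t3]] := Gex _ (filterI (filterI (N Mi) (N Ze)) (N Pl)).
  by case: (co t i) t1 t2 t3.
have Gl l : G [set t | forall i, List.In i l -> co t i = h i].
  elim: l => [|i l IH]; first by apply: filterS filterT => t _ i [].
  by apply: filterS (filterI (Hh i) IH) => t [ti tl] k [<-|Hk]; [exact: ti|exact: tl].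
have [l|s [Ss Hs]] := Hcl h.
  by have [t [St Ht]] := Gex _ (filterI GS (Gl l)); exists t.
have [U [CU Us]] := Ccov s Ss.
have [N [HN NU]] := Copen U CU s Us.
have [l Hl] := coord_sub Hco HN.
have GUU : G U.
  by apply: filterS (Gl l) => t Ht; apply/NU/Hl => i /Ht ->.
have GnU : G (~` U).
  apply: FG; exists [:: U]; split=> [V [<-|[]]//|t _ Ht]; apply: Ht; by left.
by have [t []] := Gex _ (filterI GUU GnU).
Qed.

(** * Uniformities induced from a compact space *)

Section Dense.
Variables (G : Type) (S : set T) (iota : G -> T).
Hypothesis Scpt : compact_in nb S.
Hypothesis iotaS : forall g, S (iota g).

Definition agree_unif : set (set (G * G)) :=
  [set E | exists l, forall a b, agree co l (iota a) (iota b) -> E (a, b)].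

(** A Lebesgue number argument: cover [S] by basic sets whose square lies in [N], take a finite
    subcover and concatenate its lists. Agreement on the resulting list keeps two points in a common
    member of the subcover. *)
Lemma induced_agree_unif : induced_unif nb S iota = agree_unif.
Proof.
rewrite predeqE => E; split.
  move=> [N [HN NE]].
  pose C : set (set T) := [set U | exists k l, U = [set y | agree co l k y] /\
     forall u v, S u -> S v -> agree co l k u -> agree co l k v -> N (u, v)].
  have [||ls [lsC lscov]] := Scpt (C := C).
  - by move=> U [k [l [-> _]]]; apply: basic_open.
  - move=> k Sk; have [V [Vk HV]] := HN k Sk; have [l Hl] := coord_sub Hco Vk.
    exists [set y | agree co l k y]; split; last by [].
    exists k, l; split=> // u v Su Sv Hu Hv; apply: HV => //; exact: Hl.
  have [l Hl] : exists l, forall U, List.In U ls -> forall u v, S u -> S v ->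
      U u -> agree co l u v -> N (u, v).
    elim: ls lsC {lscov} => [|U ls IH] lsC; first by exists nil.
    have [|l Hl] := IH; first by move=> V HV; apply: lsC; right.
    have [k [l' [-> Hl']]] := lsC U (or_introl erefl).
    exists (l' ++ l) => V VU u v Su Sv Uu Ha; have [H1 H2] := agree_cat Ha.
    case: VU Uu => [<-|HV] Uu.
      by apply: Hl' => //; apply: agree_trans H1.
    exact: Hl HV u v Su Sv Uu H2.
  exists l => a b Hab; apply: NE.
  have [U [lU Ua]] := lscov _ (iotaS a); exact: Hl lU _ _ _ _ Ua Hab.
move=> [l Hl]; exists [set p | agree co l p.1 p.2]; split; last by move=> a b /Hl.
move=> k Sk; have [N [HN NHl]] := coord_nb Hco k l; exists N; split=> //.
move=> u v _ _ Nu Nv; exact: agree_trans (agree_sym (NHl _ Nu)) (NHl _ Nv).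
Qed.

(** By density the basic sets centred at points of the image of [iota] cover [S]; the centres of a
    finite subcover form the required finite net. *)
Lemma agree_unif_totally_bounded :
  (forall x, S x -> cl nb (img iota) x) -> totally_bounded agree_unif.
Proof.
move=> Hd E [l Hl].
have [||ls [lsC lscov]] := Scpt
    (C := [set U | exists g, U = [set y | agree co l (iota g) y]]).
- by move=> U [g ->]; apply: basic_open.
- move=> x Sx; have /clP/(_ l) [_ [[g <-] Hg]] := Hd x Sx.
  by exists [set y | agree co l (iota g) y]; split; [exists g|apply: agree_sym].
have [xs Hxs] : exists xs : seq G, forall U, List.In U ls ->
    exists x, List.In x xs /\ U = [set y | agree co l (iota x) y].
  elim: ls lsC {lscov} => [|U ls IH] lsC; first by exists nil.
  have [|xs Hxs] := IH; first by move=> V HV; apply: lsC; right.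
  have [g Hg] := lsC U (or_introl erefl).
  exists (g :: xs) => V /= [<-|/Hxs [x [xxs ->]]]; first by exists g; split; [left|].
  by exists x; split; [right|].
exists xs => a; have [U [lU Ua]] := lscov _ (iotaS a).
have [x [xxs EU]] := Hxs U lU; exists x; split=> //; apply: Hl.
by move: Ua; rewrite EU.
Qed.
End Dense.
End Coordinates.

(** Continuity follows once each coordinate of [phi x] is determined by finitely many coordinates of
    [x], with a list that does not vary with [x]. *)
Lemma cont_on_coord (T1 T2 I1 I2 : Type) (nb1 : T1 -> set (set T1))
    (nb2 : T2 -> set (set T2)) (co1 : T1 -> I1 -> sgn) (co2 : T2 -> I2 -> sgn) S phi :
  coordinates nb1 co1 -> coordinates nb2 co2 ->
  (forall i, exists l, forall x y, agree co1 l x y -> co2 (phi y) i = co2 (phi x) i) ->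
  cont_on nb1 nb2 S phi.
Proof.
move=> H1 H2 H x Sx N /(coord_sub H2) [l Hl].
have [l' Hl'] : exists l', forall x y, agree co1 l' x y -> agree co2 l (phi x) (phi y).
  elim: l {Hl} => [|i l [l' IH]]; first by exists nil => u v _ i [].
  have [l1 Hi] := H i; exists (l1 ++ l') => u v Huv; have [Ha Hb] := agree_cat Huv; move=> k [<-|Hk].
    exact: Hi.
  exact: IH Hb k Hk.
have [M [HM Ml]] := coord_nb H1 x l'; exists M; split=> // y _ My; apply: Hl; apply: Hl'; exact: Ml.
Qed.

(** * The linear order [bm X] and its coordinates *)

Lemma sgn_lt_irr i : ~ sgn_lt i i.
Proof. by case: i. Qed.

Lemma sgn_lt_asym i j : sgn_lt i j -> sgn_lt j i -> False.
Proof. by case: i; case: j. Qed.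

Lemma sgn_total i j : [\/ sgn_lt i j, i = j | sgn_lt j i].
Proof. by case: i; case: j; (try by apply: Or31); (try by apply: Or32); apply: Or33. Qed.

Lemma infinite_notin (T : choiceType) (s : seq T) :
  infinite_set [set: T] -> exists y, y \notin s.
Proof.
move=> H; apply: contrapT => Hs; apply: H; apply: (@sub_finite_set _ _ [set` s]).
  by move=> y _; apply/negPn/negP => Hy; apply: Hs; exists y.
exact: finite_seq.
Qed.

Section Order.
Variables (d : Order.disp_t) (X : orderType d).
Implicit Types (x y z : X) (u v w : bm X) (g : aut X).

Lemma infinite_triple : infinite_set [set: X] -> exists a b c : X, a < b /\ b < c.
Proof.
move=> H; have [a _] := infinite_notin [::] H.
have [b Hb] := infinite_notin [:: a] H; have [c Hc] := infinite_notin [:: a; b] H.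
have U : uniq [:: c; b; a].
  by rewrite /= !inE andbT in Hb Hc *; rewrite Hb andbT (orbC (c == b)).
have := sort_lt_sorted [:: c; b; a]; rewrite U.
have := size_sort <=%O [:: c; b; a].
case: (sort _ _) => [|p [|q [|r []]]] //= _ /andP[pq /andP[qr _]].
by exists p, q, r.
Qed.

(* The position of [v] relative to the isolated point [Pt x Ze]. *)
Definition pos v x : sgn :=
  match v with
  | Pt y i => if y < x then Mi else if y == x then i else Pl
  | Gp A => if `[< proj1_sig A x >] then Pl else Mi
  end.

Lemma gapP (A B : gap X) : proj1_sig A = proj1_sig B -> A = B.
Proof. by case: A B => [A HA] [B HB] /= E; subst B; rewrite (Prop_irrelevance HA HB). Qed.

Lemma bm_lt_asym u v : bm_lt u v -> bm_lt v u -> False.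
Proof.
case: u v => [x i|A] [y j|B] //=.
- case=> [xy|[-> ij]] [yx|[E ji]].
  + by have := lt_trans xy yx; rewrite ltxx.
  + by rewrite E ltxx in xy.
  + by rewrite ltxx in yx.
  + exact: sgn_lt_asym ij ji.
- move=> [H N] [H' _]; apply: N; rewrite predeqE => z; split; [exact: H|exact: H'].
Qed.

Lemma bm_lt_irr u : ~ bm_lt u u.
Proof. by move=> H; exact: (bm_lt_asym H H). Qed.

Lemma bm_tri u v : [\/ bm_lt u v, u = v | bm_lt v u].
Proof.
case: u v => [x i|A] [y j|B] /=.
- case: (ltgtP x y) => [xy|yx|->]; [by apply: Or31; left|by apply: Or33; left|].
  by case: (sgn_total i j) => [H|->|H]; [apply: Or31; right|apply: Or32|apply: Or33; right].
- by case: (pselect (proj1_sig B x)) => H; [apply: Or31|apply: Or33].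
- by case: (pselect (proj1_sig A y)) => H; [apply: Or33|apply: Or31].
- case: (pselect (proj1_sig A = proj1_sig B)) => [/gapP ->|N]; first by apply: Or32.
  case: (pselect (forall z, proj1_sig A z -> proj1_sig B z)) => H; first by apply: Or31.
  apply: Or33; split; last by move=> E; apply: N.
  move=> z Bz; apply: contrapT => Az; apply: H => t At.
  case: A B At Bz Az {N} => [A [HA _ _]] [B [HB _ _]] /= At Bz Az.
  case: (leP t z) => [tz|/ltW zt]; [exact: HB tz Bz|by case: Az; exact: HA zt At].
Qed.

(** Together with its converse [lt_pos], this turns order arguments in [bm X] into case analyses on
    three values. *)
Lemma pos_lt u v x : sgn_lt (pos u x) (pos v x) -> bm_lt u v.
Proof.
case: u v => [y i|A] [z j|B] /=.
- case: (ltgtP y x) => [yx|xy|->]; case: (ltgtP z x) => [zx|xz|->] //=;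
    try (by case: i); try (by case: j); try by left.
  + by left; exact: lt_trans xz.
  + by right.
- case: asboolP => Bx; last by case: ifP => _; [|case: eqP => _ //; case: i].
  case: B Bx => [B [HB _ _]] /= Bx.
  case: (ltgtP y x) => [/ltW yx _|//|-> //]; exact: HB yx Bx.
- case: asboolP => Ax; first by case: ifP => _; [|case: eqP => _ //; case: j].
  case: A Ax => [A [HA _ _]] /= Ax.
  by case: (ltgtP z x) => [//|/ltW xz _ Az|->] //; apply: Ax; exact: HA xz Az.
- case: asboolP => Ax; case: asboolP => Bx // _.
  case: A B Ax Bx => [A [HA _ _]] [B [HB _ _]] /= Ax Bx; split; last first.
    by move=> E; rewrite E in Ax.
  move=> z Az; case: (leP z x) => [zx|/ltW xz]; first exact: HB zx Bx.
  by case: Ax; exact: HA xz Az.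
Qed.

Lemma pos_emb v x : pos v x = Ze <-> v = emb x.
Proof.
split=> [|->]; last by rewrite /= ltxx eqxx.
case: v => [y i|A] /=; last by case: asboolP.
by case: (ltgtP y x) => // -> ->.
Qed.

Lemma pos_Mi v x : pos v x = Mi <-> bm_lt v (emb x).
Proof.
have E : pos (emb x) x = Ze by apply/pos_emb.
split=> [H|H]; first by apply: (pos_lt (x := x)); rewrite H E.
case P : (pos v x) => //.
  by move/pos_emb: P H => -> /bm_lt_irr.
by case: (bm_lt_asym H); apply: (pos_lt (x := x)); rewrite P E.
Qed.

Lemma pos_Pl v x : pos v x = Pl <-> bm_lt (emb x) v.
Proof.
have E : pos (emb x) x = Ze by apply/pos_emb.
split=> [H|H]; first by apply: (pos_lt (x := x)); rewrite H E.
case P : (pos v x) => //.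
  by case: (bm_lt_asym H); apply: (pos_lt (x := x)); rewrite P E.
by move/pos_emb: P H => -> /bm_lt_irr.
Qed.

(** Excluded are the points (x,-1) and (x,1): no point of [X] separates them from (x,0). Any two
    distinct regular points are separated by a point of [X], see [reg_between]. *)
Definition reg u := match u with Pt _ Ze | Gp _ => True | _ => False end.

Definition dense_unbounded :=
  (forall x y, x < y -> exists z, x < z < y) /\ (forall x, exists y z, y < x < z).

(** Take a < b < e. Moving (a, e) to (x, y) places the image of b between x and y; moving b to x
    places the images of a and e on either side of x. *)
Lemma ultrahomogeneous_dense :
  infinite_set [set: X] -> ultrahomogeneous X -> dense_unbounded.
Proof.
move=> /infinite_triple [a [b [e [ab be]]]] H; split.
  move=> x y xy; have [||//|g [<- <-]] := H [:: a; e] [:: x; y].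
  - by rewrite /= (lt_trans ab be).
  - by rewrite /= xy.
  by exists (afun g b); rewrite !afun_lt ab be.
move=> x; have [//|//|//|g [<-]] := H [:: b] [:: x].
by exists (afun g a), (afun g e); rewrite !afun_lt ab be.
Qed.

Hypothesis Xd : dense_unbounded.

(** Points over the same x are separated at x. Over y < z a third point strictly between is taken,
    because (y,1) and (z,-1) have equal positions at both y and z. For gaps, the absence of a
    maximum or minimum supplies the point. *)
Lemma lt_pos u v : bm_lt u v -> exists x, sgn_lt (pos u x) (pos v x).
Proof.
case: u v => [y i|A] [z j|B] /=.
- case=> [yz|[-> ij]]; last by exists z; rewrite ltxx eqxx.
  have [w /andP[yw wz]] := Xd.1 _ _ yz; exists w.
  by rewrite yw (lt_gtF wz) (gt_eqF wz).
- case: B => [B [HB HB' _]] /= By; have [a [Ba ya]] := HB' _ By; exists a.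
  by rewrite ya; case: asboolP.
- case: A => [A [HA _ HA']] /= Az; have [a [Aa az]] := HA' _ Az; exists a.
  by rewrite (lt_gtF az) (gt_eqF az); case: asboolP.
- case=> H N; apply: contrapT => K; apply: N; rewrite predeqE => z; split; first exact: H.
  move=> Bz; apply: contrapT => Az; apply: K; exists z.
  by case: asboolP => //; case: asboolP.
Qed.

Lemma pos_inj u v : (forall x, pos u x = pos v x) -> u = v.
Proof.
move=> H; case: (bm_tri u v) => // /lt_pos [x]; rewrite H => /sgn_lt_irr [].
Qed.

Lemma bm_leNlt u v : bm_le u v <-> ~ bm_lt v u.
Proof.
split=> [[H K|->]|H]; [exact: bm_lt_asym H K|exact: bm_lt_irr|].
by case: (bm_tri u v) => //; [left|right].
Qed.

Lemma le_pos u v : bm_le u v <-> forall x, ~ sgn_lt (pos v x) (pos u x).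
Proof.
split=> [/bm_leNlt H x /pos_lt //|H]; apply/bm_leNlt => /lt_pos [x]; exact: H.
Qed.

Lemma bm_lt_le_trans u v w : bm_lt u v -> bm_le v w -> bm_lt u w.
Proof.
move=> /lt_pos [x H] /le_pos /(_ x) K; apply: (pos_lt (x := x)).
by move: H K; case: (pos u x); case: (pos v x); case: (pos w x).
Qed.

Lemma bm_le_lt_trans u v w : bm_le u v -> bm_lt v w -> bm_lt u w.
Proof.
move=> /le_pos H /lt_pos [x K]; apply: (pos_lt (x := x)); move: {H} (H x) K.
by case: (pos u x); case: (pos v x); case: (pos w x).
Qed.

Lemma bm_lt_trans u v w : bm_lt u v -> bm_lt v w -> bm_lt u w.
Proof. by move=> uv vw; apply: bm_lt_le_trans uv _; left. Qed.

Lemma bm_le_trans u v w : bm_le u v -> bm_le v w -> bm_le u w.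
Proof.
move=> /le_pos H /le_pos K; apply/le_pos => x; move: {H K} (H x) (K x).
by case: (pos u x); case: (pos v x); case: (pos w x).
Qed.

Lemma bm_le_total u v : bm_le u v \/ bm_le v u.
Proof. by case: (bm_tri u v) => [H|->|H]; [left; left|left; right|right; left]. Qed.

Lemma bm_le_anti u v : bm_le u v -> bm_le v u -> u = v.
Proof. by move=> [H|//] [K|//]; case: (bm_lt_asym H K). Qed.

Lemma emb_lt x y : bm_lt (emb x) (emb y) <-> x < y.
Proof. by split=> [[|[]]//|H]; left. Qed.

(** A point x with different positions of [u] and [v] works unless [u] or [v] is x itself. In that
    case regularity of the other endpoint leaves room, by density of [X] or because a gap has no
    adjacent point. *)
Lemma reg_between u v : reg u -> reg v -> bm_lt u v ->
  exists x, bm_lt u (emb x) /\ bm_lt (emb x) v.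
Proof.
move=> ru rv /lt_pos [x]; case Pu : (pos u x); case Pv : (pos v x) => // _.
- move/pos_emb: Pv rv => -> _; move/pos_Mi: Pu ru; case: u => [y i|[A [HA HA' HB']]] /=.
    case=> [yx|[-> ]]; last by case: i.
    case: i => // _; have [z /andP[yz zx]] := Xd.1 _ _ yx.
    by exists z; split; left.
  move=> /HB' [z [Az zx]] _; by exists z; split=> //; left.
- by exists x; split; [apply/pos_Mi|apply/pos_Pl].
- move/pos_emb: Pu ru => -> _; move/pos_Pl: Pv rv; case: v => [y i|[A [HA HA' HB']]] /=.
    case=> [xy|[<- ]]; last by case: i.
    case: i => // _; have [z /andP[xz zy]] := Xd.1 _ _ xy.
    by exists z; split; left.
  move=> /HA' [z [Az xz]] _; by exists z; split=> //; left.
Qed.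

Lemma empty_is_gap : is_gap (set0 : set X).
Proof.
split=> [a b _ []|a []|b _]; have [y [_ /andP[yb _]]] := Xd.2 b.
by exists y; split=> // -[].
Qed.

Lemma full_is_gap : is_gap (setT : set X).
Proof.
split=> [//|a _|b []//]; have [_ [z /andP[_ az]]] := Xd.2 a; by exists z.
Qed.

Definition bm_inf : bm X := Gp (exist _ _ empty_is_gap).
Definition bm_sup : bm X := Gp (exist _ _ full_is_gap).

Lemma pos_inf x : pos bm_inf x = Mi.
Proof. by rewrite /=; case: asboolP. Qed.

Lemma pos_sup x : pos bm_sup x = Pl.
Proof. by rewrite /=; case: asboolP. Qed.

Lemma pos_mono u x y : x < y -> pos u y <> Mi -> pos u x = Pl.
Proof.
move=> xy; case P : (pos u y) => // _; apply/pos_Pl.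
  by move/pos_emb: P => ->; left.
by move/pos_Pl: P; apply: bm_lt_trans; left.
Qed.

(** This is compactness of [bm X] in coordinates. If [h] takes the value [Ze] at x, the point is
    (x,0). Otherwise the x with [h x = Pl] form an initial segment A, and the point is (max A, 1),
    (min of the complement, -1), or the gap A. *)
Lemma bm_complete (h : X -> sgn) :
  (forall l, exists v, forall x, List.In x l -> pos v x = h x) ->
  exists v, forall x, pos v x = h x.
Proof.
move=> H.
case: (pselect (exists x, h x = Ze)) => [[x hx]|N].
  exists (emb x) => y; have [v Hv] := H [:: x; y].
  rewrite -(Hv y); last by right; left.
  by have /pos_emb -> : pos v x = Ze by rewrite Hv //; left.
pose A := [set x | h x = Pl].
have hA x : ~ A x -> h x = Mi.
  by rewrite /A /=; case E : (h x) => // _; case: N; exists x.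
have Adown a b : a <= b -> A b -> A a.
  rewrite le_eqVlt => /predU1P [->//|ab] Ab; have [v Hv] := H [:: a; b].
  rewrite /A /= -(Hv a); last by left.
  apply: (pos_mono ab); rewrite (Hv b); last by right; left.
  by rewrite Ab.
case: (pselect (exists a, A a /\ forall a', A a' -> a' <= a)) => [[a [Aa Ha]]|Nmax].
  exists (Pt a Pl) => x /=; case: (ltgtP a x) => [ax|xa|<-//].
  - by symmetry; apply: hA => /Ha; rewrite leNgt ax.
  - by symmetry; apply: Adown Aa; apply: ltW.
case: (pselect (exists a, ~ A a /\ forall a', ~ A a' -> a <= a')) => [[a [Aa Ha]]|Nmin].
  exists (Pt a Mi) => x /=; case: (ltgtP a x) => [ax|xa|<-//].
  - by symmetry; apply: hA => /(Adown _ _ (ltW ax)).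
  - by symmetry; apply: contrapT => /Ha; rewrite leNgt xa.
  - by symmetry; apply: hA.
have gA : is_gap A.
  split=> //.
  - move=> a Aa; apply: contrapT => K; apply: Nmax; exists a; split=> // a' Aa'.
    by rewrite leNgt; apply/negP => aa'; apply: K; exists a'.
  - move=> a Aa; apply: contrapT => K; apply: Nmin; exists a; split=> // a' Aa'.
    by rewrite leNgt; apply/negP => aa'; apply: K; exists a'.
exists (Gp (exist _ A gA)) => x /=; case: asboolP => [//|]; by move/hA.
Qed.

Lemma ord_nb_inter u N M : ord_nb u N -> ord_nb u M ->
  exists K, ord_nb u K /\ forall v, K v -> N v /\ M v.
Proof.
move=> [l [r [lu [ur ->]]]] [l' [r' [lu' [ur' ->]]]].
have [l1 [H1 H2]] : exists l1, Defs.lbound l1 u /\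
    forall v, Defs.lbound l1 v -> Defs.lbound l v /\ Defs.lbound l' v.
  case: l l' lu lu' => [l|] [l'|] /= lu lu'.
  - case: (bm_le_total l l') => H; [exists (Some l')|exists (Some l)]; split=> //= v Hv;
      split=> //; exact: bm_le_lt_trans H Hv.
  - by exists (Some l).
  - by exists (Some l').
  - by exists None.
have [r1 [H3 H4]] : exists r1, Defs.ubound r1 u /\
    forall v, Defs.ubound r1 v -> Defs.ubound r v /\ Defs.ubound r' v.
  case: r r' ur ur' => [r|] [r'|] /= ur ur'.
  - case: (bm_le_total r r') => H; [exists (Some r)|exists (Some r')]; split=> //= v Hv;
      split=> //; exact: bm_lt_le_trans Hv H.
  - by exists (Some r).
  - by exists (Some r').
  - by exists None.
exists [set v | Defs.lbound l1 v /\ Defs.ubound r1 v]; split; first by exists l1, r1.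
by move=> v [/H2 [? ?] /H4 [? ?]].
Qed.

Lemma bm_coordinates : coordinates (@ord_nb _ X) pos.
Proof.
split; last exact: pos_inj.
- move=> u _ [l [r [lu [ur ->]]]].
  have [s1 H1] : exists s, forall v, agree pos s u v -> Defs.lbound l v.
    case: l lu => [l|_] /=; last by exists nil.
    move=> /lt_pos [x Hx]; exists [:: x] => v Hv; apply: (pos_lt (x := x)).
    by rewrite (Hv x (or_introl erefl)).
  have [s2 H2] : exists s, forall v, agree pos s u v -> Defs.ubound r v.
    case: r ur => [r|_] /=; last by exists nil.
    move=> /lt_pos [x Hx]; exists [:: x] => v Hv; apply: (pos_lt (x := x)).
    by rewrite (Hv x (or_introl erefl)).
  by exists (s1 ++ s2) => v Huv; have [/H1 ? /H2 ?] := agree_cat Huv.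
- move=> u; elim=> [|x s [N [uN HN]]].
    exists setT; split=> [|v _ i []]; exists None, None; split=> //; split=> //.
    by rewrite predeqE.
  have [M [uM HM]] : exists M, ord_nb u M /\ forall v, M v -> pos v x = pos u x.
    case P : (pos u x).
    + exists [set v | True /\ bm_lt v (emb x)]; split; last by move=> v [_ /pos_Mi].
      by exists None, (Some (emb x)); split=> //; split=> //; apply/pos_Mi.
    + move/pos_emb: P => ->.
      (* The point (x,0) is isolated: it is the only point strictly between (x,-1) and (x,1). *)
      exists [set v | bm_lt (Pt x Mi) v /\ bm_lt v (Pt x Pl)]; split.
        exists (Some (Pt x Mi)), (Some (Pt x Pl)); split; first by right.
        by split=> //; right.
      move=> v [H K]; apply/pos_emb.
      case: v H K => [y j|A] /=; last by [].
      case=> [xy|[<- Hj]] [yx|[E Hj']].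
      * by have := lt_trans xy yx; rewrite ltxx.
      * by rewrite E ltxx in xy.
      * by rewrite ltxx in yx.
      * by case: j Hj Hj'.
    + exists [set v | bm_lt (emb x) v /\ True]; split; last by move=> v [/pos_Pl].
      by exists (Some (emb x)), None; split=> //; apply/pos_Pl.
  have [K [uK HK]] := ord_nb_inter uN uM; exists K; split=> // v /HK [Nv Mv] i [<-|Hi].
    exact: HM.
  exact: HN Nv _ Hi.
Qed.

End Order.

(** * Automorphisms *)

Lemma In_mem (T : eqType) (x : T) s : List.In x s <-> x \in s.
Proof.
elim: s => [//|y s IH]; rewrite inE; split=> [[->|/IH ->]|/predU1P[->|/IH]].
- by rewrite eqxx.
- by rewrite orbT.
- by left.
- by right.
Qed.

Lemma list_sort (T : Type) (R : T -> T -> Prop) :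
  (forall x y, R x y \/ R y x) -> (forall x y z, R x y -> R y z -> R x z) ->
  forall L, exists L', Sorted.StronglySorted R L' /\
    forall x, List.In x L <-> List.In x L'.
Proof.
move=> Rtot Rtr; elim=> [|x L [L' [SL' HL']]].
  by exists nil; split=> //; constructor.
have [L1 [S1 H1]] : exists L1, Sorted.StronglySorted R L1 /\
    forall y, (x = y \/ List.In y L') <-> List.In y L1.
  elim: L' SL' {HL'} => [|y L' IH] SL'.
    by exists [:: x]; split=> //; constructor; constructor.
  have [SL /List.Forall_forall yL] := Sorted.StronglySorted_inv SL'.
  case: (Rtot x y) => Rxy.
    exists [:: x, y & L']; split=> //; constructor=> //; apply/List.Forall_forall.
    by move=> z [<-//|/yL]; apply: Rtr.
  have [L1 [S1 H1]] := IH SL; exists (y :: L1); split.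
    constructor=> //; apply/List.Forall_forall => z /H1 [<-//|]; exact: yL.
  by move=> z /=; rewrite -H1; tauto.
by exists L1; split=> // y; rewrite -H1 -HL'.
Qed.

Section Aut.
Variables (d : Order.disp_t) (X : orderType d).
Implicit Types (x y z : X) (u v : bm X) (g a b q : aut X).

Lemma pos_act g u x : pos (act g u) x = pos u (ainv g x).
Proof.
case: u => [y i|A] //=.
by rewrite -{1 2}(ainvK g x) afun_lt (inj_eq (can_inj (afunK g))).
Qed.

Lemma aut_eq a b : (forall x, afun a x = afun b x) -> a = b.
Proof.
case: a b => [f f' fK f'K fm] [h h' hK h'K hm] /= E.
have E1 : f = h by exact: funext.
have E2 : f' = h' by apply: funext => x; apply: (can_inj fK); rewrite f'K E1 h'K.
by subst h h'; congr Aut; exact: Prop_irrelevance.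
Qed.

Definition aut_comp a b : aut X.
Proof.
refine (@Aut _ X (afun a \o afun b) (ainv b \o ainv a) _ _ _).
- by move=> x /=; rewrite !afunK.
- by move=> x /=; rewrite !ainvK.
- by move=> x y /=; rewrite !afun_mono.
Defined.

Definition aut_inv a : aut X := Aut (ainvK a) (afunK a) (ainv_mono a).

(** * Patching and gluing automorphisms *)

Definition patch_fun a b x0 x := if x <= x0 then afun a x else afun b x.

Lemma patch_fun_homo a b x0 : afun a x0 = afun b x0 ->
  {homo patch_fun a b x0 : x y / x < y}.
Proof.
move=> E x y xy; rewrite /patch_fun.
case: (leP x x0) => xx0; case: (leP y x0) => yx0; rewrite ?afun_lt //.
  by apply: (@le_lt_trans _ _ (afun a x0)); rewrite ?afun_mono // E afun_lt.
by have := lt_trans (lt_le_trans xy yx0) xx0; rewrite ltxx.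
Qed.

(** The inverse is the patch of the inverses at the common value of [a] and [b] at [x0]. *)
Lemma aut_patch a b x0 : afun a x0 = afun b x0 ->
  exists q, (forall x, x <= x0 -> afun q x = afun a x) /\
            (forall x, x0 <= x -> afun q x = afun b x).
Proof.
move=> E.
have K1 : cancel (patch_fun a b x0) (patch_fun (aut_inv a) (aut_inv b) (afun a x0)).
  move=> x; rewrite /patch_fun; case: (leP x x0) => xx0; first by rewrite afun_mono xx0 /= afunK.
  by rewrite E afun_mono leNgt xx0 /= afunK.
have K2 : cancel (patch_fun (aut_inv a) (aut_inv b) (afun a x0)) (patch_fun a b x0).
  move=> y; rewrite /patch_fun /=; case: (leP y (afun a x0)) => yy0.
    by rewrite -(afun_mono a) ainvK yy0.
  by rewrite -(afun_mono b) ainvK -E leNgt yy0.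
exists (Aut K1 K2 (le_mono (patch_fun_homo E))); split=> x xx0 /=; rewrite /patch_fun.
  by rewrite xx0.
case: (leP x x0) => // H; have -> : x = x0 by apply: le_anti; rewrite H.
exact: E.
Qed.

Lemma act_lt g u v : bm_lt u v -> dense_unbounded X -> bm_lt (act g u) (act g v).
Proof.
move=> uv Xd; have [x Hx] := lt_pos Xd uv; apply: (pos_lt (x := afun g x)).
by rewrite !pos_act afunK.
Qed.

Hypothesis Xd : dense_unbounded X.
Hypothesis Xh : ultrahomogeneous X.

Lemma act_comp a b u : act (aut_comp a b) u = act a (act b u).
Proof. by apply: (pos_inj Xd) => x; rewrite !pos_act. Qed.

Lemma act_invK a u : act (aut_inv a) (act a u) = u.
Proof. by apply: (pos_inj Xd) => x; rewrite !pos_act /= afunK. Qed.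

Lemma act_inj a u v : act a u = act a v -> u = v.
Proof. by move=> E; rewrite -(act_invK a u) E act_invK. Qed.

Lemma act_emb a x : act a (emb x) = emb (afun a x).
Proof. by []. Qed.

Lemma act_reg a u : reg (act a u) <-> reg u.
Proof. by case: u => [? []|]. Qed.

(** Compare positions at y. If one preimage of y is at most [x0], both preimages coincide; if both
    exceed [x0], then [u] lies below both. *)
Lemma act_eq_below a b x0 u : (forall x, x <= x0 -> afun a x = afun b x) ->
  bm_lt u (emb x0) -> act a u = act b u.
Proof.
move=> H Hu; apply: (pos_inj Xd) => y; rewrite !pos_act.
have K x : x0 < x -> pos u x = Mi.
  by move=> x0x; apply/pos_Mi; apply: (bm_lt_trans Xd Hu); left.
case: (leP (ainv a y) x0) => Ha.
  by have := H _ Ha; rewrite ainvK => E; rewrite {2}E afunK.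
case: (leP (ainv b y) x0) => Hb; last by rewrite !K.
by have := H _ Hb; rewrite ainvK => E; rewrite -{1}E afunK.
Qed.

Lemma act_eq_above a b x0 u : (forall x, x0 <= x -> afun a x = afun b x) ->
  bm_lt (emb x0) u -> act a u = act b u.
Proof.
move=> H Hu; apply: (pos_inj Xd) => y; rewrite !pos_act.
have K x : x < x0 -> pos u x = Pl.
  by move=> x0x; apply/pos_Pl; apply: (bm_lt_trans Xd _ Hu); left.
case: (leP x0 (ainv a y)) => Ha.
  by have := H _ Ha; rewrite ainvK => E; rewrite {2}E afunK.
case: (leP x0 (ainv b y)) => Hb; last by rewrite !K.
by have := H _ Hb; rewrite ainvK => E; rewrite -{1}E afunK.
Qed.

(** Ultrahomogeneity gives [g] with the value of [a] at x and that of [b] at y; patch [a] with [g]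
    at x, then the result with [b] at y. *)
Lemma splice a b x y : x < y -> afun a x < afun b y ->
  exists q, (forall t, t <= x -> afun q t = afun a t) /\
            (forall t, y <= t -> afun q t = afun b t).
Proof.
move=> xy axby.
have [||//|g [Ex Ey]] := Xh (s := [:: x; y]) (t := [:: afun a x; afun b y]).
- by rewrite /= xy.
- by rewrite /= axby.
have [q1 [H1 H2]] := aut_patch (esym Ex).
have [|q [K1 K2]] := @aut_patch q1 b y; first by rewrite H2 // ltW.
exists q; split=> // t tx; rewrite K1; first exact: H1.
by rewrite (le_trans tx) // ltW.
Qed.

Lemma act_ltE g u v : bm_lt (act g u) (act g v) <-> bm_lt u v.
Proof.
split=> H; last exact: act_lt.
by rewrite -(act_invK g u) -(act_invK g v); apply: act_lt.
Qed.

Lemma between2r u s t : reg u -> reg s -> reg t -> bm_lt u s -> bm_lt u t ->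
  exists y, [/\ bm_lt u (emb y), bm_lt (emb y) s & bm_lt (emb y) t].
Proof.
move=> ru rs rt us ut; case: (bm_le_total s t) => H.
  have [y [uy ys]] := reg_between Xd ru rs us.
  by exists y; split=> //; apply: bm_lt_le_trans H.
have [y [uy yt]] := reg_between Xd ru rt ut.
by exists y; split=> //; apply: bm_lt_le_trans H.
Qed.

Lemma between2l s t u : reg u -> reg s -> reg t -> bm_lt s u -> bm_lt t u ->
  exists y, [/\ bm_lt s (emb y), bm_lt t (emb y) & bm_lt (emb y) u].
Proof.
move=> ru rs rt su tu; case: (bm_le_total s t) => H.
  have [y [ty yu]] := reg_between Xd rt ru tu.
  by exists y; split=> //; apply: bm_le_lt_trans ty.
have [y [sy yu]] := reg_between Xd rs ru su.
by exists y; split=> //; apply: bm_le_lt_trans sy.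
Qed.

(** [splice] is applied at x < y in [X] between [u] and [v]. First [y1] is chosen above [act a u]
    and below the images of [v] under [a] and [b], and x is its preimage under [a]. Then [y2] is
    chosen above [y1] and the image of x under [b], below [act b v], and y is its preimage under
    [b]. *)
Lemma splice_bm a b u v : reg u -> reg v -> bm_lt u v -> bm_lt (act a u) (act b v) ->
  exists q x y, [/\ bm_lt u (emb x), bm_lt (emb y) v,
    (forall t, t <= x -> afun q t = afun a t) &
    (forall t, y <= t -> afun q t = afun b t)].
Proof.
move=> ru rv uv auv.
have [y1 [H1 H2 H3]] : exists y1,
    [/\ bm_lt (act a u) (emb y1), bm_lt (emb y1) (act b v) & bm_lt (emb y1) (act a v)].
  by apply: between2r; rewrite ?act_reg //; apply/act_ltE.
pose x := ainv a y1.
have Ex : act a (emb x) = emb y1 by rewrite act_emb ainvK.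
have ux : bm_lt u (emb x) by apply/(act_ltE a); rewrite Ex.
have xv : bm_lt (emb x) v by apply/(act_ltE a); rewrite Ex.
have [y2 [H4 H5 H6]] : exists y2, [/\ bm_lt (emb y1) (emb y2),
    bm_lt (act b (emb x)) (emb y2) & bm_lt (emb y2) (act b v)].
  by apply: between2l => //; [rewrite act_reg|apply/act_ltE].
pose y := ainv b y2.
have Ey : act b (emb y) = emb y2 by rewrite act_emb ainvK.
have xy : x < y by apply/emb_lt/(act_ltE b); rewrite Ey.
have yv : bm_lt (emb y) v by apply/(act_ltE b); rewrite Ey.
have [|q [K1 K2]] := splice (a := a) (b := b) xy.
  by apply/emb_lt; rewrite -!act_emb Ex Ey.
by exists q, x, y.
Qed.

(** The tail is realised by one automorphism [b]. If [u] equals the first point [v] of the tail, [b]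
    already has the right value at [u]. Otherwise [splice_bm] joins [a] near [u] to [b] from a point
    below [v] on, hence on the whole tail. *)
Lemma glue_sorted (L : seq (bm X * aut X)) :
  Sorted.StronglySorted (fun p p' : bm X * aut X => bm_le p.1 p'.1) L ->
  (forall p, List.In p L -> reg p.1) ->
  (forall p p', List.In p L -> List.In p' L -> bm_lt p.1 p'.1 ->
     bm_lt (act p.2 p.1) (act p'.2 p'.1)) ->
  (forall p p', List.In p L -> List.In p' L -> p.1 = p'.1 ->
     act p.2 p.1 = act p'.2 p'.1) ->
  exists q, forall p, List.In p L -> act q p.1 = act p.2 p.1.
Proof.
elim: L => [|[u a] L IH] SL Lreg Llt Leq.
  by exists (Aut (fun x => erefl) (fun x => erefl) (fun x y => erefl)).
have [SL' /List.Forall_forall uL] := Sorted.StronglySorted_inv SL.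
have [||||b Hb] := IH; first by [].
- by move=> p Hp; apply: Lreg; right.
- by move=> p p' Hp Hp'; apply: Llt; right.
- by move=> p p' Hp Hp'; apply: Leq; right.
case: L SL' uL Hb Lreg Llt Leq {IH SL} => [|[v b'] L] SL uL Hb Lreg Llt Leq.
  by exists a => p [<-|[]].
have I1 : List.In (u, a) [:: (u, a), (v, b') & L] by left.
have I2 : List.In (v, b') [:: (u, a), (v, b') & L] by right; left.
have I3 : List.In (v, b') ((v, b') :: L) by left.
case: (uL _ I3) => /= [uv|uv]; last first.
  by exists b => p [<-|/Hb //]; have /= <- := Leq _ _ I2 I1 (esym uv); rewrite uv; exact: (Hb _ I3).
have [|||q [x [y [ux yv qa qb]]]] := @splice_bm a b u v _ _ uv.
- exact: Lreg I1.
- exact: Lreg I2.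
- by have /= -> := Hb _ I3; exact: (Llt _ _ I1 I2).
exists q => p [<-|Hp]; first exact: act_eq_below qa ux.
rewrite -(Hb _ Hp); apply: act_eq_above qb _; apply: (bm_lt_le_trans Xd yv).
case: Hp => [<-|Hp]; first by right.
have [_ /List.Forall_forall vL] := Sorted.StronglySorted_inv SL.
exact: vL Hp.
Qed.

Lemma glue (L : seq (bm X * aut X)) :
  (forall p, List.In p L -> reg p.1) ->
  (forall p p', List.In p L -> List.In p' L -> bm_lt p.1 p'.1 ->
     bm_lt (act p.2 p.1) (act p'.2 p'.1)) ->
  (forall p p', List.In p L -> List.In p' L -> p.1 = p'.1 ->
     act p.2 p.1 = act p'.2 p'.1) ->
  exists q, forall p, List.In p L -> act q p.1 = act p.2 p.1.
Proof.
have [||L' [SL' HL']] := @list_sort (bm X * aut X) (fun p p' : bm X * aut X => bm_le p.1 p'.1) _ _ L.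
- by move=> p q; apply: bm_le_total.
- by move=> p q r; apply: bm_le_trans.
move=> H1 H2 H3; have [|||q Hq] := glue_sorted SL'.
- by move=> p /HL'; apply: H1.
- by move=> p p' /HL' + /HL'; apply: H2.
- by move=> p p' /HL' + /HL'; apply: H3.
by exists q => p /HL' /Hq.
Qed.

(** * Approximation by automorphisms *)

Lemma list_bm_max (D : seq (bm X)) (P : bm X -> Prop) u0 : List.In u0 D -> P u0 ->
  exists m, [/\ List.In m D, P m & forall u, List.In u D -> P u -> bm_le u m].
Proof.
elim: D u0 => [//|v D IH] u0 Hu Pu.
case: (pselect (exists u, List.In u D /\ P u)) => [[u [uD Pu']]|N]; last first.
  have H u : List.In u (v :: D) -> P u -> v = u.
    by case=> // uD Pu'; case: N; exists u.
  have E := H _ Hu Pu; subst u0; exists v; split; [by left|by []|].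
  by move=> w wD Pw; right; rewrite (H w).
have [m [mD Pm Hm]] := IH u uD Pu'.
case: (pselect (P v /\ bm_le m v)) => [[Pv mv]|N].
  exists v; split; [by left|by []|].
  move=> w [<- _|wD Pw]; [by right|exact: (bm_le_trans Xd (Hm w wD Pw) mv)].
exists m; split; [by right|by []|].
move=> w [<- Pv|]; last exact: Hm.
by case: (bm_le_total v m) => // mv; case: N.
Qed.

Lemma list_bm_min (D : seq (bm X)) (P : bm X -> Prop) u0 : List.In u0 D -> P u0 ->
  exists m, [/\ List.In m D, P m & forall u, List.In u D -> P u -> bm_le m u].
Proof.
elim: D u0 => [//|v D IH] u0 Hu Pu.
case: (pselect (exists u, List.In u D /\ P u)) => [[u [uD Pu']]|N]; last first.
  have H u : List.In u (v :: D) -> P u -> v = u.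
    by case=> // uD Pu'; case: N; exists u.
  have E := H _ Hu Pu; subst u0; exists v; split; [by left|by []|].
  by move=> w wD Pw; right; rewrite (H w).
have [m [mD Pm Hm]] := IH u uD Pu'.
case: (pselect (P v /\ bm_le v m)) => [[Pv mv]|N].
  exists v; split; [by left|by []|].
  move=> w [<- _|wD Pw]; [by right|exact: (bm_le_trans Xd mv (Hm w wD Pw))].
exists m; split; [by right|by []|].
move=> w [<- Pv|]; last exact: Hm.
by case: (bm_le_total m v) => // mv; case: N.
Qed.

Section Approx.
Variables (D : seq (bm X)) (f : bm X -> bm X).
Let bi := bm_inf Xd.
Let bs := bm_sup Xd.
Hypothesis Dreg : forall u, List.In u D -> reg u.
Hypothesis Dinf : List.In bi D.
Hypothesis Dsup : List.In bs D.
Hypothesis finf : f bi = bi.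
Hypothesis fsup : f bs = bs.
Hypothesis fle : forall u v, List.In u D -> List.In v D -> bm_le u v -> bm_le (f u) (f v).
Hypothesis finX : forall u, List.In u D -> inX (f u) -> inX u.
Hypothesis finj : forall u v, List.In u D -> List.In v D -> f u = f v -> inX (f u) -> u = v.

Let flt u v : List.In u D -> List.In v D -> bm_lt (f u) (f v) -> bm_lt u v.
Proof.
move=> uD vD H; apply: contrapT => /bm_leNlt vu.
by have /bm_leNlt := fle vD uD vu; apply.
Qed.

(** The condition for [x] to serve as the preimage of [z] under the approximating automorphism. *)
Let compat z x := forall u, List.In u D -> pos u x = pos (f u) z.

(** The bound [t] keeps the new point below those already chosen. If [f u] is z for some [u] in [D],
    then [u] lies in [X] and is the forced choice. Otherwise any point of [X] works that lies
    between the last [u] sent below z and the first one sent above z; these exist because [D]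
    contains inf and sup. *)
Lemma approx_step z t : reg t ->
  (forall u, List.In u D -> bm_le (f u) (emb z) -> bm_lt u t) ->
  exists w, bm_lt (emb w) t /\ compat z w.
Proof.
move=> treg Ht.
case: (pselect (exists u, List.In u D /\ f u = emb z)) => [[u [uD fu]]|N].
  have [x Ex] : inX u by apply: finX => //; exists z.
  exists x; split; first by rewrite -Ex; apply: Ht => //; right.
  move=> v vD; case: (bm_tri (f v) (f u)) => H.
  - have K := flt vD uD H; rewrite fu Ex in H K *.
    by rewrite (pos_Mi v x).2 // (pos_Mi (f v) z).2.
  - have E : v = u by apply: finj => //; rewrite H; exists z.
    by rewrite E fu Ex (pos_emb (emb x) x).2 // (pos_emb (emb z) z).2.
  - have K := flt uD vD H; rewrite fu Ex in H K *.
    by rewrite (pos_Pl v x).2 // (pos_Pl (f v) z).2.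
have Pinf : bm_lt (f bi) (emb z) by apply/pos_Mi; rewrite finf pos_inf.
have Psup : bm_lt (emb z) (f bs) by apply/pos_Pl; rewrite fsup pos_sup.
have [l [lD lz lmax]] := list_bm_max (P := fun u => bm_lt (f u) (emb z)) Dinf Pinf.
have [r [rD zr rmin]] := list_bm_min (P := fun u => bm_lt (emb z) (f u)) Dsup Psup.
have [w [lw wt wr]] : exists w, [/\ bm_lt l (emb w), bm_lt (emb w) t & bm_lt (emb w) r].
  apply: between2r => //; try exact: Dreg.
    by apply: Ht => //; left.
  apply: flt => //; exact: bm_lt_trans lz zr.
exists w; split=> // u uD; case P : (pos (f u) z).
- by apply/pos_Mi/(bm_le_lt_trans Xd _ lw)/lmax => //; apply/pos_Mi.
- by move/pos_emb: P => fu; case: N; exists u.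
- by apply/pos_Pl/(bm_lt_le_trans Xd wr)/rmin => //; apply/pos_Pl.
Qed.

Lemma approx_sorted Z : sorted <%O Z ->
  exists W, sorted <%O W /\ List.Forall2 compat Z W.
Proof.
elim: Z => [|z Z IH] SZ; first by exists nil; split=> //; constructor.
have [W [SW HW]] := IH (path_sorted SZ).
(* Preimages are chosen from the largest element of [Z] downwards: [t] is the smallest one chosen so
   far, or sup at the start. *)
have [t [treg Ht tW]] : exists t, [/\ reg t,
    forall u, List.In u D -> bm_le (f u) (emb z) -> bm_lt u t &
    forall w, bm_lt (emb w) t -> path <%O w W].
  case: HW SZ SW {IH} => [|z' w' Z' W' Hw' HW'] SZ SW.
    exists bs; split=> // u uD fu; apply: flt => //; apply: (bm_le_lt_trans Xd fu).
    by rewrite fsup; apply/pos_Pl; rewrite pos_sup.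
  have /andP[zz' _] : (z < z') && path <%O z' Z' by [].
  exists (emb w'); split=> //; last by move=> w /emb_lt ww' /=; rewrite ww'.
  move=> u uD fu; apply/pos_Mi; rewrite Hw' //; apply/pos_Mi.
  by apply: (bm_le_lt_trans Xd fu); apply/emb_lt.
have [w [wt Hw]] := approx_step treg Ht.
by exists (w :: W); split; [exact: tW|constructor].
Qed.

Lemma approx_aut (Z : seq X) : exists g, forall u z, List.In u D -> List.In z Z ->
  pos (act g u) z = pos (f u) z.
Proof.
pose Z' := sort <=%O (undup Z).
have SZ : sorted <%O Z' by rewrite sort_lt_sorted undup_uniq.
have [W [SW HW]] := approx_sorted SZ.
(* [g] carries the chosen points to the points of [Z], so they become the preimages under [g]. *)
have [|g Hg] := Xh SW SZ; first by rewrite -[size Z']/(length Z') (List.Forall2_length HW).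
exists g => u z uD zZ; rewrite pos_act.
have {zZ} : List.In z Z'.
  by apply/In_mem; rewrite mem_sort mem_undup; apply/In_mem.
elim: HW Hg {SZ SW} => [//|z1 w1 Z1 W1 H1 HW IH] /= [E EW] [<-|zZ].
  by rewrite -{1}E afunK; exact: H1.
exact: IH EW zZ.
Qed.
End Approx.
End Aut.

(** * The compactifications *)

Lemma cl_imgP (G T I : Type) (nb : T -> set (set T)) (co : T -> I -> sgn)
    (iota : G -> T) x : coordinates nb co ->
  cl nb (img iota) x <-> forall l, exists g, agree co l x (iota g).
Proof.
move=> Hco; rewrite (clP Hco); split=> H l.
  by have [_ [[g <-] Hg]] := H l; exists g.
by have [g Hg] := H l; exists (iota g); split=> //; exists g.
Qed.

Section Main.
Variables (d : Order.disp_t) (X : orderType d).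
Implicit Types (x y z : X) (u v : bm X).
Hypothesis Xd : dense_unbounded X.
Hypothesis Xh : ultrahomogeneous X.
Let co A := pw_co (A := A) (@pos _ X).
Let pwP A := pw_coordinates A (bm_coordinates Xd).

(** For each argument t the prescribed positions are finitely approximated by values of [iota g], so
    [bm_complete] yields a limit value; the limit function is again approximated by the [iota g]. *)
Lemma compact_cl_img (A G : Type) (iota : G -> A -> bm X) :
  compact_in (pw_nb (@ord_nb _ X)) (cl (pw_nb (@ord_nb _ X)) (img iota)).
Proof.
apply: (compact_coord (pwP A)) => h Hh.
have Hh' l : exists g, forall p, List.In p l -> pos (iota g p.1) p.2 = h p.
  have [s [/(cl_imgP _ _ (pwP A)) Hs Hl]] := Hh l; have [g Hg] := Hs l.
  by exists g => p Hp; rewrite -(Hl p Hp); exact: (Hg p Hp).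
have /choice [f Hf] : forall t, exists v, forall x, pos v x = h (t, x).
  move=> t; apply: (bm_complete Xd) => l.
  have [g Hg] := Hh' (List.map (pair t) l); exists (iota g t) => x Hx.
  exact: (Hg (t, x) (List.in_map _ _ _ Hx)).
have E p : co f p = h p by case: p => t x; apply: Hf.
exists f; split; last exact: E.
apply/(cl_imgP _ _ (pwP A)) => l; have [g Hg] := Hh' l.
by exists g => p Hp; rewrite -/(co f p) E; exact: Hg.
Qed.

(* If [x] is sent to [v], condition (c)(iv) forces [(x, j)] to be sent to [spread v j]. *)
Definition spread v j := match v with Pt y Ze => Pt y j | _ => v end.

Lemma pos_spread v j z : pos (spread v j) z = match pos v z with Ze => j | s => s end.
Proof.
case: v => [y i|A] /=; last by case: asboolP.
by case: i => /=; case: (ltgtP y z).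
Qed.

Lemma act_spread (g : aut X) x j : act g (Pt x j) = spread (act g (emb x)) j.
Proof. by []. Qed.

Lemma spread_notX v j : ~ inX v -> spread v j = v.
Proof. by case: v => // y [] // H; case: H; exists y. Qed.

Lemma Cset_spread f : Cset f -> forall x j, f (Pt x j) = spread (f (emb x)) j.
Proof.
case=> _ _ _ H _ x j; case: (H x) => [[E1 [E2 N]]|[y [E1 E2 E3]]].
  by rewrite spread_notX //; case: j; rewrite ?E1 -?E2.
by rewrite E2; case: j.
Qed.

Lemma act_trivial_gap g (A : gap X) :
  proj1_sig A = set0 \/ proj1_sig A = setT -> act g (Gp A) = Gp A.
Proof. by move=> H; apply: (pos_inj Xd) => x /=; case: H => ->. Qed.

Lemma act_eq_emb g u z : act g u = emb z -> u = emb (ainv g z).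
Proof. by move=> E; apply: (act_inj Xd (a := g)); rewrite E act_emb ainvK. Qed.

Lemma act_notX g u : ~ inX u -> ~ inX (act g u).
Proof. by move=> N [z /act_eq_emb E]; apply: N; rewrite E; eexists. Qed.

Lemma inf_le u : bm_le (bm_inf Xd) u.
Proof. by apply/(le_pos Xd) => x; rewrite pos_inf; case: (pos u x). Qed.

Lemma le_sup u : bm_le u (bm_sup Xd).
Proof. by apply/(le_pos Xd) => x; rewrite pos_sup; case: (pos u x). Qed.

Lemma embR_Dset (g : aut X) : Dset (embR g).
Proof.
split=> [x y|x y xy [/(can_inj (afunK g))] //].
rewrite le_eqVlt => /predU1P [->|xy]; [by right|by left; left; rewrite afun_lt].
Qed.

Lemma embK_inj : injective (@embK _ X).
Proof.
move=> a b E; apply: aut_eq => x; have : embK a (emb x) = embK b (emb x) by rewrite E.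
by case.
Qed.

Lemma embR_inj : injective (@embR _ X).
Proof.
move=> a b E; apply: aut_eq => x; have : embR a x = embR b x by rewrite E.
by case.
Qed.

Lemma eKP (F : bm X -> bm X) : eK F <-> forall l, exists g, agree (@co (bm X)) l F (act g).
Proof. exact: cl_imgP (pwP _). Qed.

(** The conditions defining [Cset] can be checked on two positions at a time, so each passes from
    automorphisms to the closure through this lemma. *)
Lemma eK_approx2 (F : bm X -> bm X) u x v y : eK F -> exists g,
  pos (act g u) x = pos (F u) x /\ pos (act g v) y = pos (F v) y.
Proof.
move=> /eKP /(_ [:: (u, x); (v, y)]) [g Hg]; exists g; split.
  by apply: (Hg (u, x)); left.
by apply: (Hg (v, y)); right; left.
Qed.

Lemma Cset_eK (F : bm X -> bm X) : Cset F -> eK F.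
Proof.
move=> CF; have [Fle FnX Finj _ Fgap] := CF; apply/eKP => l.
(* [approx_aut] asks for regular points, so (x,j) is replaced by (x,0); [Cset_spread] then recovers
   the position of its image. *)
pose r u := match u with Pt x _ => emb x | Gp A => Gp A end.
pose D := [:: bm_inf Xd, bm_sup Xd & List.map (r \o fst) l].
have [||||||||g Hg] := @approx_aut _ X Xd Xh D F _ _ _ _ _ _ _ _ (List.map snd l).
all: try by [].
- move=> u [<-//|[<-//|/List.in_map_iff [[v z] [<- _]]]]; by case: v.
- by left.
- by right; left.
- by have [H _] := Fgap (exist _ _ (empty_is_gap Xd)); exact: H.
- by have [_ H] := Fgap (exist _ _ (full_is_gap Xd)); exact: H.
- by move=> u v _ _; apply: Fle.
- by move=> u _ FX; apply: contrapT => /FnX.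
- by move=> u v _ _ E FX; apply: contrapT => /Finj /(_ E).
exists g => -[u z] Hp; have /= zl := List.in_map snd _ _ Hp; rewrite /co /pw_co /=.
have Hu : List.In (r u) D by right; right; exact: (List.in_map (r \o fst) _ _ Hp).
case: u Hu {Hp} => [x j|A] Hu; last exact: Hg Hu zl.
by rewrite act_spread (Cset_spread CF) !pos_spread (Hg _ _ Hu zl).
Qed.

Lemma eK_Cset (F : bm X -> bm X) : eK F -> Cset F.
Proof.
move=> HF.
have Fspr x j : F (Pt x j) = spread (F (emb x)) j.
  apply: (pos_inj Xd) => z.
  have [g [H1 H2]] := eK_approx2 (Pt x j) z (emb x) z HF.
  by rewrite -H1 act_spread !pos_spread H2.
have act_pos u z g : pos (act g u) z = pos (F u) z -> F u = emb z -> act g u = emb z.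
  by move=> H E; apply/pos_emb; rewrite H; apply/pos_emb.
split.
- move=> u v [uv|->]; last by right.
  apply/(le_pos Xd) => z; have [g [<- <-]] := eK_approx2 u z v z HF.
  by move: z; apply/(le_pos Xd); left; apply: act_lt.
- move=> u N [z E]; have [g [H _]] := eK_approx2 u z u z HF.
  by apply: (act_notX N); exists z; apply: act_pos H E.
- move=> u v uv E [z Ez]; have [g [H1 H2]] := eK_approx2 u z v z HF.
  apply: uv; apply: (act_inj Xd (a := g)).
  by rewrite (act_pos _ _ _ H1 Ez) (act_pos _ _ _ H2) // -E.
- move=> x; rewrite (Fspr x Mi) (Fspr x Pl) -/(emb x).
  case: (pselect (inX (F (emb x)))) => [[y E]|N]; [right; exists y; by rewrite E|left].
  by rewrite !spread_notX.
- move=> A; have H : proj1_sig A = set0 \/ proj1_sig A = setT -> F (Gp A) = Gp A.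
    move=> HA; apply: (pos_inj Xd) => z.
    have [g [H _]] := eK_approx2 (Gp A) z (Gp A) z HF.
    by rewrite -H -/(act g (Gp A)) act_trivial_gap.
  by split=> E; apply: H; [left|right].
Qed.

Lemma cl_embRP (f : X -> bm X) : cl (pw_nb (@ord_nb _ X)) (img (@embR _ X)) f <->
  forall l, exists g, agree (@co X) l f (embR g).
Proof. exact: cl_imgP (pwP _). Qed.

Lemma Dset_cl (f : X -> bm X) : Dset f -> cl (pw_nb (@ord_nb _ X)) (img (@embR _ X)) f.
Proof.
move=> [fle finj]; apply/cl_embRP => l.
(* Besides points of [X], the list [D] contains only inf and sup, which [F] fixes. *)
pose F u := match u with Pt x _ => f x | Gp A => Gp A end.
pose D := [:: bm_inf Xd, bm_sup Xd & List.map (@emb _ X \o fst) l].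
have Dcase u : List.In u D -> [\/ u = bm_inf Xd, u = bm_sup Xd | exists x, u = emb x].
  move=> [<-|[<-|/List.in_map_iff [p [<- _]]]]; [exact: Or31|exact: Or32|].
  by apply: Or33; exists p.1.
have FD u : List.In u D -> inX (F u) -> exists x, u = emb x.
  by move=> /Dcase [->|->|//] [].
have [||||||||g Hg] := @approx_aut _ X Xd Xh D F _ _ _ _ _ _ _ _ (List.map snd l).
all: try by [].
- by move=> u /Dcase [->|->|[x ->]].
- by left.
- by right; left.
- move=> u v /Dcase [->|->|[x ->]] /Dcase [->|->|[y ->]] uv;
    try exact: inf_le; try exact: le_sup.
  + exact: uv.
  + by have := bm_le_anti uv (le_sup _).
  + by have := bm_le_anti uv (inf_le _).
  + apply: fle; case: uv => [/emb_lt /ltW //|[->] //].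
- move=> u v uD vD E FX; have [x Ex] := FD u uD FX.
  have [y Ey] : exists y, v = emb y by apply: FD => //; rewrite -E.
  subst u v; congr emb; apply: contrapT => /finj /(_ E) //.
exists g => -[x z] Hp; apply: Hg; last exact: (List.in_map snd _ _ Hp).
right; right; exact: (List.in_map (@emb _ X \o fst) _ _ Hp).
Qed.

Lemma cl_Dset (f : X -> bm X) : cl (pw_nb (@ord_nb _ X)) (img (@embR _ X)) f -> Dset f.
Proof.
move=> Hf.
have H2 x s y t : exists g, pos (embR g x) s = pos (f x) s /\ pos (embR g y) t = pos (f y) t.
  move/cl_embRP: Hf => /(_ [:: (x, s); (y, t)]) [g Hg]; exists g; split.
    by apply: (Hg (x, s)); left.
  by apply: (Hg (y, t)); right; left.
split=> x y.
  move=> xy; apply/(le_pos Xd) => z; have [g [<- <-]] := H2 x z y z.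
  by move: z; apply/(le_pos Xd); apply: (embR_Dset g).1.
move=> xy E [z Ez]; apply: xy; have [g [K1 K2]] := H2 x z y z.
have Zz : pos (emb z) z = Ze by apply/pos_emb.
rewrite -E Ez Zz in K1 K2; move/pos_emb: K1 => K1; move/pos_emb: K2 => K2.
by have [/(can_inj (afunK g))] : embR g x = embR g y by rewrite K1 K2.
Qed.
End Main.

(** * Double coset uniformities, completions and comparison maps *)

Section Uniformities.
Variables (d : Order.disp_t) (X : orderType d).
Implicit Types (x y z : X) (u v : bm X) (a b q : aut X).
Hypothesis Xd : dense_unbounded X.
Hypothesis Xh : ultrahomogeneous X.
Let co A := pw_co (A := A) (@pos _ X).
Let pwP A := pw_coordinates A (bm_coordinates Xd).

(** The right factor fixes [u] and the left factor fixes [z], so neither affects the position. *)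
Lemma dcos_pos (g : aut X) F s a u z : dcos (stabX F) (stabB s) g a ->
  List.In u s -> List.In z F -> pos (act a u) z = pos (act g u) z.
Proof.
move=> [o [p [Ho [Hp E]]]] us zF.
have -> : a = aut_comp o (aut_comp g p) by apply: aut_eq => x; rewrite E.
by rewrite !(act_comp Xd) pos_act (Hp u us) -{1}(Ho z zF) afunK.
Qed.

Definition centre u := match u with Pt x _ => emb x | Gp A => Gp A end.

Lemma act_centre a u : act a (centre u) = centre u -> act a u = u.
Proof. by case: u => [x i|A] //= [->]. Qed.

(* The double coset is obtained by gluing [b] on the points of [s] with [a] on the
   preimages of the points of [F]. *)
Lemma pos_dcos F s a b :
  (forall u z, List.In u s -> List.In z F ->
     pos (act b (centre u)) z = pos (act a (centre u)) z) ->
  dcos (stabX F) (stabB s) a b.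
Proof.
move=> H.
pose L := List.map (fun u => (centre u, b)) s ++
          List.map (fun z => (emb (ainv a z), a)) F.
have LP p : List.In p L -> (exists u, List.In u s /\ p = (centre u, b)) \/
    (exists z, List.In z F /\ p = (emb (ainv a z), a)).
  move=> Hp; case: (List.in_app_or _ _ _ Hp) => /List.in_map_iff [t [<- Ht]].
    by left; exists t.
  by right; exists t.
have K u z : List.In u s -> List.In z F ->
    pos (act b (centre u)) z = pos (centre u) (ainv a z).
  by move=> us zF; rewrite H // pos_act.
have aE z : act a (emb (ainv a z)) = emb z by rewrite act_emb ainvK.
have [|||q Hq] := glue Xd Xh (L := L).
- by move=> p /LP [[u [_ ->]]|[z [_ ->]]] //; case: u.
- move=> p p' /LP [[u [us ->]]|[z [zF ->]]] /LP [[v [vs ->]]|[t [tF ->]]];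
    cbn [fst snd] => uv; try exact: act_lt.
  + by rewrite aE; apply/pos_Mi; rewrite K //; apply/pos_Mi.
  + by rewrite aE; apply/pos_Pl; rewrite K //; apply/pos_Pl.
- move=> p p' /LP [[u [us ->]]|[z [zF ->]]] /LP [[v [vs ->]]|[t [tF ->]]];
    cbn [fst snd] => uv; try by rewrite uv.
  + by rewrite aE; apply/pos_emb; rewrite K //; apply/pos_emb.
  + by rewrite aE; symmetry; apply/pos_emb; rewrite K //; apply/pos_emb.
have qb u : List.In u s -> act q (centre u) = act b (centre u).
  by move=> us; apply: (Hq (centre u, b)); apply: List.in_or_app; left;
     exact: (List.in_map (fun u => (centre u, b)) _ _ us).
have qa z : List.In z F -> afun q (ainv a z) = z.
  move=> zF; have : act q (emb (ainv a z)) = act a (emb (ainv a z)).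
    by apply: (Hq (emb (ainv a z), a)); apply: List.in_or_app; right;
       exact: (List.in_map (fun z => (emb (ainv a z), a)) _ _ zF).
  by rewrite aE => -[].
(* The factors are o = q a^-1 and p = q^-1 b, so that o a p = b. *)
exists (aut_comp q (aut_inv a)), (aut_comp (aut_inv q) b); split; last split.
- by move=> z zF; exact: qa.
- by move=> u us; apply: act_centre; rewrite (act_comp Xd) -qb // (act_invK Xd).
- by move=> x /=; rewrite afunK ainvK.
Qed.

Lemma dcos_refl F s a : dcos (stabX F) (stabB s) a a.
Proof. by apply: pos_dcos. Qed.

(** Roelcke double cosets thereby become double cosets [dcos (stabX F) (stabB s)], with [s] the
    image of [F] in [bm X]. *)
Lemma stabX_emb F : stabX F = stabB (List.map (@emb _ X) F).
Proof.
rewrite predeqE => h; split=> H.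
  by move=> _ /List.in_map_iff [x [<- Hx]]; rewrite act_emb H.
by move=> x Hx; have [] := H _ (List.in_map (@emb _ X) _ _ Hx).
Qed.

Lemma R_Sigma_bm_agree : @R_Sigma_bm _ X = agree_unif (@co (bm X)) (@embK _ X).
Proof.
rewrite predeqE => E; split.
  move=> [_ [[F [s ->]] HE]]; exists (List.list_prod (List.map centre s) F) => a b Hab.
  apply: HE; exists (dcos (stabX F) (stabB s) a); split; first by exists a.
  split; first exact: dcos_refl.
  apply: pos_dcos => u z us zF; apply: (Hab (centre u, z)).
  by apply/List.in_prod_iff; split=> //; apply: List.in_map.
move=> [l Hl]; pose F := List.map snd l; pose s := List.map fst l.
eexists; split; first by exists F, s; reflexivity.
move=> [a b] [_ [[g ->] [/= Ha Hb]]]; apply: Hl => p Hp.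
have us := List.in_map fst _ _ Hp; have zF := List.in_map snd _ _ Hp.
by transitivity (pos (act g p.1) p.2); [|symmetry]; [exact: dcos_pos Hb us zF|exact: dcos_pos Ha us zF].
Qed.

Lemma roelcke_agree : @roelcke_unif _ X = agree_unif (@co X) (@embR _ X).
Proof.
rewrite predeqE => E; split.
  move=> [_ [[F ->] HE]]; exists (List.list_prod F F) => a b Hab.
  apply: HE; exists (dcos (stabX F) (stabX F) a); split; first by exists a.
  rewrite {2 4}stabX_emb; split; first exact: dcos_refl.
  apply: pos_dcos => _ z /List.in_map_iff [x [<- Hx]] zF; apply: (Hab (x, z)).
  by apply/List.in_prod_iff.
(* The same stabilizer acts on both sides, so [F] collects the arguments as well as the test
   points. *)
move=> [l Hl]; pose F := List.map fst l ++ List.map snd l.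
eexists; split; first by exists F; reflexivity.
move=> [a b] [_ [[g ->] [/= Ha Hb]]]; apply: Hl => p Hp.
rewrite {2}stabX_emb in Ha; rewrite {2}stabX_emb in Hb.
have us : List.In (emb p.1) (List.map (@emb _ X) F).
  by apply: List.in_map; apply: List.in_or_app; left; exact: (List.in_map fst _ _ Hp).
have zF : List.In p.2 F.
  by apply: List.in_or_app; right; exact: (List.in_map snd _ _ Hp).
by transitivity (pos (act g (emb p.1)) p.2); [|symmetry]; [exact: dcos_pos Hb us zF|exact: dcos_pos Ha us zF].
Qed.

Lemma cl_completion (A : Type) (iota : aut X -> A -> bm X) : injective iota ->
  is_completion (agree_unif (@co A) iota) (pw_nb (@ord_nb _ X))
    (cl (pw_nb (@ord_nb _ X)) (img iota)) iota.
Proof.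
move=> Hi; have HS g : cl (pw_nb (@ord_nb _ X)) (img iota) (iota g).
  by apply/(cl_imgP _ _ (pwP A)) => l; exists g.
have Hc := compact_cl_img Xd (iota := iota).
split=> //; last by rewrite (induced_agree_unif (pwP A) Hc HS).
by split=> //; apply: hausdorff_coord (pwP A) _.
Qed.

Lemma eK_Cset_eq : @eK _ X = @Cset _ X.
Proof.
by rewrite predeqE => F; split; [apply: eK_Cset|apply: Cset_eK].
Qed.

Lemma cl_Dset_eq : cl (pw_nb (@ord_nb _ X)) (img (@embR _ X)) = @Dset _ X.
Proof.
by rewrite predeqE => f; split; [apply: cl_Dset|apply: Dset_cl].
Qed.

Lemma roelcke_completion :
  is_completion (@roelcke_unif _ X) (pw_nb (@ord_nb _ X)) (@Dset _ X) (@embR _ X).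
Proof. by rewrite roelcke_agree -cl_Dset_eq; apply: cl_completion; apply: embR_inj. Qed.

Lemma roelcke_precompactness : roelcke_precompact X.
Proof.
rewrite /roelcke_precompact roelcke_agree.
apply: (agree_unif_totally_bounded (pwP X) (S := @Dset _ X)).
- by rewrite -cl_Dset_eq; apply: compact_cl_img.
- exact: embR_Dset.
- by move=> f /(Dset_cl Xd Xh).
Qed.

Lemma eK_restrict_Dset F : eK F -> Dset (fun x => F (emb x)).
Proof.
move=> /(eK_Cset Xd) [Fle _ Finj _ _]; split=> [x y xy|x y xy]; last by apply: Finj => -[].
by apply: Fle; case: (ltgtP x y) xy => // [xy|->] _; [left; left|right].
Qed.

Lemma eK_restrict_cont : cont_on (pw_nb (@ord_nb _ X)) (pw_nb (@ord_nb _ X)) (@eK _ X)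
  (fun F x => F (emb x)).
Proof.
apply: (cont_on_coord (pwP _) (pwP _)) => -[x z]; exists [:: (emb x, z)] => F F' H.
by apply: (H (emb x, z)); left.
Qed.

Lemma Dset_le_eK : comp_le (pw_nb (@ord_nb _ X)) (@Dset _ X) (@embR _ X)
  (pw_nb (@ord_nb _ X)) (@eK _ X) (@embK _ X).
Proof.
exists (fun F x => F (emb x)); split; first exact: eK_restrict_Dset.
by split=> //; exact: eK_restrict_cont.
Qed.

(* Every point of [bm X] is a value of some element of [Dset]: the points of [X]
   of the inclusion, the others of constant maps. *)
Lemma Dset_value (x0 : X) u : exists p : Dt X * X, proj1_sig p.1 p.2 = u.
Proof.
case: (pselect (inX u)) => [[x ->]|N].
  by exists (exist _ _ (embR_Dset (Aut (fun x => erefl) (fun x => erefl) (fun x y => erefl))), x).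
have HD : Dset (fun _ : X => u) by split=> // x y _; right.
by exists (exist _ _ HD, x0).
Qed.

(** For [Phi] in the closure, [Phi f x] depends only on the value [f x], as it does for
    automorphisms. Since every point of [bm X] is such a value, [Phi] amounts to a self-map of
    [bm X], and the inverse is composition with [F]. *)
Lemma eD_iso_eK (x0 : X) : comp_iso (pw_nb (pw_nb (@ord_nb _ X))) (@eD _ X) (@embD _ X)
  (pw_nb (@ord_nb _ X)) (@eK _ X) (@embK _ X).
Proof.
have /choice [r Hr] := Dset_value x0.
have ppP := pw_coordinates (Dt X) (pwP X).
have eDP Phi : cl (pw_nb (pw_nb (@ord_nb _ X))) (img (@embD _ X)) Phi <->
    forall l, exists g, agree (pw_co (@co X)) l Phi (embD g).
  exact: cl_imgP ppP.
exists (fun Phi u => Phi (r u).1 (r u).2), (fun F f x => F (proj1_sig f x)); split.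
- split.
    move=> Phi [_ /eDP HPhi]; apply/(eKP Xd) => l.
    have [g Hg] := HPhi (List.map (fun p => ((r p.1).1, ((r p.1).2, p.2))) l).
    exists g => -[u z] Hp.
    have := Hg _ (List.in_map (fun p => ((r p.1).1, ((r p.1).2, p.2))) _ _ Hp).
    by rewrite /co /pw_co /= /embD Hr.
  move=> F HF; split.
    have [Fle FnX Finj _ _] := eK_Cset Xd HF.
    case=> f [fle finj]; split=> /= x y xy; first by apply: Fle; apply: fle.
    (* If [f] already identifies x and y, their common value is outside [X] and [F] keeps it there;
       otherwise injectivity of [F] over [X] applies. *)
    case: (pselect (f x = f y)) => [/(finj _ _ xy)/FnX //|N]; exact: Finj N.
  apply/eDP => l; move/(eKP Xd): HF.
  move=> /(_ (List.map (fun p => (proj1_sig p.1 p.2.1, p.2.2)) l)) [g Hg].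
  exists g => -[f [x z]] Hp.
  exact: (Hg _ (List.in_map (fun p => (proj1_sig p.1 p.2.1, p.2.2)) _ _ Hp)).
- split; last by move=> F _; apply: funext => u; rewrite Hr.
  move=> Phi [_ /eDP HPhi]; apply: funext => f; apply: funext => x.
  apply: (pos_inj Xd) => z; set p := r _.
  (* Approximating at two pairs with the same value shows that the choice made by [r] is
     immaterial. *)
  have [g Hg] := HPhi [:: (p.1, (p.2, z)); (f, (x, z))].
  have := Hg _ (or_introl erefl); have := Hg _ (or_intror (or_introl erefl)).
  by rewrite /co /pw_co /= /embD /p Hr => <- <-.
- split.
    apply: (cont_on_coord ppP (pwP _)) => -[u z].
    exists [:: ((r u).1, ((r u).2, z))] => Phi Phi' H.
    by apply: (H ((r u).1, ((r u).2, z))); left.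
  apply: (cont_on_coord (pwP _) ppP) => -[f [x z]].
  exists [:: (proj1_sig f x, z)] => F F' H.
  by apply: (H (proj1_sig f x, z)); left.
- by move=> g; apply: funext => u; rewrite /embD Hr.
Qed.

(** When inf and sup are the only gaps, an element of [eK] is determined by its restriction to [X]:
    [spread] gives its values at (x,-1) and (x,1), and the gaps are fixed. *)
Lemma Dset_iso_eK : continuously_ordered X ->
  comp_iso (pw_nb (@ord_nb _ X)) (@Dset _ X) (@embR _ X)
    (pw_nb (@ord_nb _ X)) (@eK _ X) (@embK _ X).
Proof.
move=> [_ Xgap].
pose phi (f : X -> bm X) u := match u with Pt x j => spread (f x) j | Gp A => Gp A end.
have phi_co f f' u z : (forall x j, u = Pt x j -> pos (f' x) z = pos (f x) z) ->
    pos (phi f' u) z = pos (phi f u) z.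
  by case: u => [x j|A] //= H; rewrite !pos_spread (H x j).
have phi_emb g : phi (embR g) = embK g.
  by apply: funext => -[x j|A] //; rewrite /embK act_trivial_gap.
have phi_embE f x : phi f (emb x) = f x.
  by rewrite /phi /=; case: (f x) => // y [].
exists phi, (fun F x => F (emb x)); split.
- split.
    move=> f /(Dset_cl Xd Xh) /(cl_embRP Xd) Hf; apply/(eKP Xd) => l.
    (* Gaps contribute no condition, since [phi f] fixes them for every [f]. *)
    have [g Hg] := Hf (List.flat_map
      (fun p => match p.1 with Pt x _ => [:: (x, p.2)] | _ => [::] end) l).
    exists g => -[u z] Hp; rewrite /co /pw_co /= -/(embK g) -phi_emb.
    apply: phi_co => x j E; subst u; apply: (Hg (x, z)).
    by apply/List.in_flat_map; exists (Pt x j, z); split=> //; left.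
  exact: eK_restrict_Dset.
- split.
    by move=> f _; apply: funext => x; exact: phi_embE.
  move=> F /(eK_Cset Xd) CF; apply: funext => -[x j|A] /=.
    by rewrite -Cset_spread.
  by have [_ _ _ _ /(_ A) [H0 H1]] := CF; case: (Xgap A) => HA; symmetry; [exact: H0|exact: H1].
- split.
    apply: (cont_on_coord (pwP _) (pwP _)) => -[u z].
    exists (match u with Pt x _ => [:: (x, z)] | _ => [::] end) => f f' H.
    by apply: phi_co => x j /= E; rewrite E in H; apply: (H (x, z)); left.
  exact: eK_restrict_cont.
- exact: phi_emb.
Qed.
End Uniformities.

Theorem mainTheorem16 (d : Order.disp_t) (X : orderType d) :
  infinite_set [set: X] -> ultrahomogeneous X ->
  [/\ (* (a) *)
      is_completion (@R_Sigma_bm _ X) (@pw_nb _ _ (@ord_nb _ X)) (@eK _ X) (@embK _ X),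
      (* (b) *)
      [/\ roelcke_precompact X,
          comp_le (@pw_nb _ _ (@ord_nb _ X)) (@Dset _ X) (@embR _ X)
                  (@pw_nb _ _ (@ord_nb _ X)) (@eK _ X) (@embK _ X) &
          comp_iso (@pw_nb _ _ (@pw_nb _ _ (@ord_nb _ X))) (@eD _ X) (@embD _ X)
                   (@pw_nb _ _ (@ord_nb _ X)) (@eK _ X) (@embK _ X)],
      (* (c) *)
      @eK _ X = @Cset _ X,
      (* (d) *)
      is_completion (@roelcke_unif _ X) (@pw_nb _ _ (@ord_nb _ X)) (@Dset _ X) (@embR _ X) &
      (* continuously ordered case *)
      continuously_ordered X ->
        comp_iso (@pw_nb _ _ (@ord_nb _ X)) (@Dset _ X) (@embR _ X)
                 (@pw_nb _ _ (@ord_nb _ X)) (@eK _ X) (@embK _ X)].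
Proof.
move=> Xinf Xh; have Xd := ultrahomogeneous_dense Xinf Xh.
have [x0 _] := infinite_notin [::] Xinf.
split.
- by rewrite R_Sigma_bm_agree //; apply: (cl_completion Xd); exact: embK_inj.
- split; [exact: roelcke_precompactness|exact: Dset_le_eK|exact: eD_iso_eK].
- exact: eK_Cset_eq.
- exact: roelcke_completion.
- exact: Dset_iso_eK.
Qed.
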